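(* For every ring $R$ there exist a ring $Q^{\sigma}_{\mathrm{tot}}(R)$ and an injective ring epimorphism $f:R\to Q^{\sigma}_{\mathrm{tot}}(R)$ such that (1) $f$ makes $Q^{\sigma}_{\mathrm{tot}}(R)$ into a left and right flat $R$-module; (2) if $g:R\to S$ is an injective ring epimorphism that makes $S$ into a left and right flat $R$-module, then there is a unique monomorphism $\overline{g}:S\to Q^{\sigma}_{\mathrm{tot}}(R)$ with $f=\overline{g}g$.
   Context: Rings are associative with identity. A ring homomorphism $f:R\to S$ is a ring epimorphism if for all rings $T$ and homomorphisms $g,h:S\to T$, $gf=hf$ implies $g=h$. Monomorphism means injective ring homomorphism. *)

(* Defs.v *)
From HB Require Import structures.
From mathcomp Require Import all_boot all_order all_algebra.
From mathcomp Require Import boolp.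
From mathcomp Require Import freeg.

Set Implicit Arguments.
Unset Strict Implicit.
Unset Printing Implicit Defensive.

Import GRing.Theory.
Local Open Scope ring_scope.
Local Open Scope quotient_scope.

(* Rings are [pzRingType]: associative, with identity, not assumed commutative,
   and the zero ring is allowed.  A left R-module is an [lmodType R]; a right
   R-module is an [lmodType R^c] over the converse ring, [(r : R^c) *: x]
   standing for x.r. *)

Definition ring_epi (R S : pzRingType) (f : {rmorphism R -> S}) : Prop :=
  forall (T : pzRingType) (g h : {rmorphism S -> T}), g \o f =1 h \o f -> g =1 h.

Section Tensor.
Variables (R : pzRingType) (M : lmodType R^c) (N : lmodType R).

Definition pure_word (x : M) (y : N) : {freeg (M * N)%type} := << (x, y) >>.

(* The tensor product of M and N over R is the free abelian group on the set
   M * N modulo the subgroup [tensor_null]. *)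
Inductive tensor_null : {freeg (M * N)%type} -> Prop :=
| tensor_nullDl x x' y :
    tensor_null (pure_word (x + x') y - (pure_word x y + pure_word x' y))
| tensor_nullDr x y y' :
    tensor_null (pure_word x (y + y') - (pure_word x y + pure_word x y'))
| tensor_nullZ x (r : R) y :
    tensor_null (pure_word ((r : R^c) *: x) y - pure_word x (r *: y))
| tensor_null0 : tensor_null 0
| tensor_nullB t u : tensor_null t -> tensor_null u -> tensor_null (t - u).

Definition tensor_nullb : {pred {freeg (M * N)%type}} := fun t => `[< tensor_null t >].

Lemma tensor_nullbP : zmod_closed tensor_nullb.
Proof.
split=> [|t u /asboolP t0 /asboolP u0]; apply/asboolP; first exact: tensor_null0.
exact: tensor_nullB.
Qed.

HB.instance Definition _ :=
  GRing.isZmodClosed.Build {freeg (M * N)%type} tensor_nullb tensor_nullbP.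

Definition tensor : zmodType := Quotient.quot (tensor_nullb : zmodClosed _).

Definition tensor_class : {freeg (M * N)%type} -> tensor :=
  \pi_(Quotient.quot (tensor_nullb : zmodClosed _)).

Definition tensor_repr : tensor -> {freeg (M * N)%type} :=
  @repr _ (Quotient.quot (tensor_nullb : zmodClosed _)).

Definition pure_tensor (x : M) (y : N) : tensor := tensor_class (pure_word x y).

Lemma tensor_reprK : cancel tensor_repr tensor_class.
Proof. exact: reprK. Qed.

Lemma tensor_class_eq t u :
  tensor_class t = tensor_class u <-> tensor_null (t - u).
Proof.
rewrite /tensor_class; split=> [/eqP|h].
  by rewrite -Quotient.idealrBE => /asboolP.
by apply/eqP; rewrite -Quotient.idealrBE; apply/asboolP.
Qed.

End Tensor.

Section TensorMap.
Variables (R : pzRingType) (M M' : lmodType R^c) (N N' : lmodType R).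
Variables (f : {linear M -> M'}) (g : {linear N -> N'}).

Definition word_map : {freeg (M * N)%type} -> {freeg (M' * N')%type} :=
  fglift (fun p => pure_word (f p.1) (g p.2)).

(* f tensor g, computed on a representative; [tensor_map_class] says that the
   choice does not matter. *)
Definition tensor_map (t : tensor M N) : tensor M' N' :=
  tensor_class (word_map (tensor_repr t)).

Lemma word_map_pure x y : word_map (pure_word x y) = pure_word (f x) (g y).
Proof. by rewrite /word_map liftU scale1r. Qed.

Lemma word_mapB : zmod_morphism word_map.
Proof. by move=> t u; rewrite /word_map lift_is_additive. Qed.

HB.instance Definition _ := GRing.isZmodMorphism.Build
  {freeg (M * N)%type} {freeg (M' * N')%type} word_map word_mapB.

Lemma word_map_null t : tensor_null t -> tensor_null (word_map t).
Proof.
elim=> [x x' y|x y y'|x r y||{}t u _ IHt _ IHu].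
- by rewrite raddfB raddfD /= !word_map_pure linearD; apply: tensor_nullDl.
- by rewrite raddfB raddfD /= !word_map_pure linearD; apply: tensor_nullDr.
- by rewrite raddfB /= !word_map_pure !linearZ; apply: tensor_nullZ.
- by rewrite raddf0; apply: tensor_null0.
- by rewrite raddfB; apply: tensor_nullB.
Qed.

Lemma tensor_map_class t :
  tensor_map (tensor_class t) = tensor_class (word_map t).
Proof.
apply/tensor_class_eq; rewrite -raddfB; apply: word_map_null.
by apply/tensor_class_eq; rewrite tensor_reprK.
Qed.

Lemma tensor_map_pure x y :
  tensor_map (pure_tensor x y) = pure_tensor (f x) (g y).
Proof. by rewrite /pure_tensor tensor_map_class word_map_pure. Qed.

End TensorMap.

Definition right_flat (R : pzRingType) (M : lmodType R^c) : Prop :=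
  forall (N N' : lmodType R) (g : {linear N -> N'}),
    injective g -> injective (tensor_map (idfun : {linear M -> M}) g).

Definition left_flat (R : pzRingType) (N : lmodType R) : Prop :=
  forall (M M' : lmodType R^c) (f : {linear M -> M'}),
    injective f -> injective (tensor_map f (idfun : {linear N -> N})).

(* S as a left, resp. right, R-module through f : R -> S. *)
Section Restriction.
Variables (R S : pzRingType) (f : {rmorphism R -> S}).

Definition left_restr of {rmorphism R -> S} : Type := S.
Definition right_restr of {rmorphism R -> S} : Type := S.

HB.instance Definition _ := GRing.Zmodule.on (left_restr f).
HB.instance Definition _ := GRing.Zmodule.on (right_restr f).

Definition left_scale (r : R) (s : left_restr f) : left_restr f :=
  f r * (s : S).
Definition right_scale (r : R^c) (s : right_restr f) : right_restr f :=
  (s : S) * f (r : R).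

Lemma left_scaleA a b v : left_scale a (left_scale b v) = left_scale (a * b) v.
Proof. by rewrite /left_scale mulrA rmorphM. Qed.
Lemma left_scale1 : left_id 1 left_scale.
Proof. by move=> v; rewrite /left_scale rmorph1 mul1r. Qed.
Lemma left_scaleDr : right_distributive left_scale +%R.
Proof. by move=> a u v; apply: mulrDr. Qed.
Lemma left_scaleDl v : {morph left_scale^~ v : a b / a + b}.
Proof. by move=> a b; rewrite /left_scale rmorphD; apply: mulrDl. Qed.

HB.instance Definition _ := GRing.Zmodule_isLmodule.Build R (left_restr f)
  left_scaleA left_scale1 left_scaleDr left_scaleDl.

Lemma right_scaleA a b v :
  right_scale a (right_scale b v) = right_scale (a * b) v.
Proof. by rewrite /right_scale -mulrA -rmorphM. Qed.
Lemma right_scale1 : left_id 1 right_scale.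
Proof. by move=> v; rewrite /right_scale rmorph1 mulr1. Qed.
Lemma right_scaleDr : right_distributive right_scale +%R.
Proof. by move=> a u v; apply: mulrDl. Qed.
Lemma right_scaleDl v : {morph right_scale^~ v : a b / a + b}.
Proof. by move=> a b; rewrite /right_scale rmorphD; apply: mulrDr. Qed.

HB.instance Definition _ := GRing.Zmodule_isLmodule.Build R^c (right_restr f)
  right_scaleA right_scale1 right_scaleDr right_scaleDl.

End Restriction.

Definition left_right_flat (R S : pzRingType) (f : {rmorphism R -> S}) : Prop :=
  left_flat (left_restr f) /\ right_flat (right_restr f).

(* Main.v *)
Require Import Defs.
From HB Require Import structures.
From mathcomp Require Import all_boot all_order all_algebra.
From mathcomp Require Import boolp functions.
From mathcomp Require Import freeg.

(** A map f : R -> S is an injective epimorphism making S left flat exactly when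
    f is injective and every s in S is a sum of left fractions: the unit of S is
    a finite sum of terms f r * x for which s * f r lies in f R.
    [flat_epi_left_fractions] gives one direction: the inclusion of
    M = s f R + f R in S stays injective after tensoring with S, an epimorphism
    identifies s ⊗ 1 with 1 ⊗ s, and comparing these two elements of M ⊗ S yields
    the sum.  [left_fractions_epi] and [left_fractions_flat] give the converse.
    The condition never mentions modules, and it is stable under subtraction and
    products of elements ([stably_denomB], [stably_denomM]); hence, inside a fixed
    overring of R, the subring generated by any family of subrings satisfying it
    satisfies it again.  The right-hand condition is the same one for the
    opposite rings, by [left_flat_op] and [right_flat_op].

    What remains is one overring containing all candidates S.  If s is a sum of
    left fractions, its right ideal of denominators is dense, so s is determined
    by the right R-linear map r |-> s * r from this ideal to R.  Thus S embeds
    over R in the ring of germs of right R-linear maps defined on dense right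
    ideals, the maximal right ring of quotients of R ([germ_embed_inj]).  The
    required ring is the subring of the ring of germs generated by all subrings
    that contain R and satisfy both conditions, with coefficients in themselves;
    the image of every flat epimorphic extension is one of these
    ([germ_embed_tot]).  Uniqueness of the factorization is the definition of an
    epimorphism. *)

Set Implicit Arguments.
Unset Strict Implicit.
Unset Printing Implicit Defensive.

Import GRing.Theory.
Local Open Scope ring_scope.
Local Open Scope quotient_scope.

(** * Sums of left fractions *)

Section Span.
Variables (R S : pzRingType) (f : {rmorphism R -> S}).

(** The coefficients [x] are restricted to [A] because the condition is needed
    for subrings of a ring of germs, given there only by a predicate. *)
Inductive left_span (A : S -> Prop) (P : R -> Prop) : S -> Prop :=
| left_span0 : left_span A P 0
| left_span_gen r x : P r -> A x -> left_span A P (f r * x)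
| left_spanB s t : left_span A P s -> left_span A P t -> left_span A P (s - t).

Definition covers (A : S -> Prop) (P : R -> Prop) := left_span A P 1.

Definition denom (s : S) (r : R) := exists r', s * f r = f r'.

(** An element is a sum of left fractions when its denominators, with
    coefficients in [A], generate the unit ideal. *)
Definition has_denom (A : S -> Prop) (s : S) := covers A (denom s).

Lemma left_spanN A P s : left_span A P s -> left_span A P (- s).
Proof. by move=> hs; rewrite -sub0r; apply: left_spanB hs; apply: left_span0. Qed.

Lemma left_spanD A P s t : left_span A P s -> left_span A P t -> left_span A P (s + t).
Proof. by move=> hs ht; rewrite -[t]opprK; apply: left_spanB => //; apply: left_spanN. Qed.

Lemma left_span_sub A P P' s : (forall r, P r -> P' r) -> left_span A P s -> left_span A P' s.
Proof.
move=> sub; elim=> [|r x Pr Ax|{}s t _ hs _ ht]; first exact: left_span0.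
  by apply: left_span_gen => //; apply: sub.
exact: left_spanB.
Qed.

Lemma left_span_mulr (A : S -> Prop) P s y :
  (forall x z, A x -> A z -> A (x * z)) -> A y -> left_span A P s -> left_span A P (s * y).
Proof.
move=> AM Ay; elim=> [|r x Pr Ax|{}s t _ hs _ ht]; first by rewrite mul0r; apply: left_span0.
  by rewrite -mulrA; apply: left_span_gen => //; apply: AM.
by rewrite mulrBl; apply: left_spanB.
Qed.

Lemma left_span_mull A P s r : left_span A (fun r' => P (r * r')) s -> left_span A P (f r * s).
Proof.
elim=> [|r' x Pr Ax|{}s t _ hs _ ht]; first by rewrite mulr0; apply: left_span0.
  by rewrite mulrA -rmorphM; apply: left_span_gen.
by rewrite mulrBr; apply: left_spanB.
Qed.

(** Covers compose as in a Grothendieck topology: if 1 is the sum of the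
    f r * x and, for each r, also the sum of the f r' * y, then it is the sum of
    the f (r * r') * (y * x). *)
Lemma covers_bind (A : S -> Prop) (P P' : R -> Prop) :
    (forall x z, A x -> A z -> A (x * z)) ->
  covers A P -> (forall r, P r -> covers A (fun r' => P' (r * r'))) ->
  covers A P'.
Proof.
move=> AM cov step; rewrite /covers; elim: cov => [|r x Pr Ax|s t _ hs _ ht].
- exact: left_span0.
- rewrite -[f r]mulr1; apply: left_span_mulr => //; apply: left_span_mull; exact: step.
- exact: left_spanB.
Qed.

Lemma covers_all (A : S -> Prop) (P : R -> Prop) : A 1 -> (forall r, P r) -> covers A P.
Proof.
move=> A1 Pall; suff: left_span A P (f 1 * 1) by rewrite mulr1 rmorph1.
exact: left_span_gen.
Qed.

Variable A : S -> Prop.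
Hypothesis AM : forall x z, A x -> A z -> A (x * z).

(** Quantifying over right multiples by R makes the condition an induction
    hypothesis: a denominator chosen for one element turns the other one into
    such a multiple. *)
Definition stably_denom s := forall a, has_denom A (s * f a).

Lemma stably_denomB s t : stably_denom s -> stably_denom t -> stably_denom (s - t).
Proof.
move=> hs ht a; refine (covers_bind AM (hs a) _) => r [b sb].
apply: left_span_sub (ht (a * r)) => r' [c tc].
by exists (b * r' - c); rewrite rmorphB !rmorphM -sb -tc rmorphM !mulrBl !mulrA.
Qed.

Lemma stably_denomM s t : stably_denom s -> stably_denom t -> stably_denom (s * t).
Proof.
move=> hs ht a; refine (covers_bind AM (ht a) _) => r [b tb].
apply: left_span_sub (hs b) => r' [c sc].
by exists c; rewrite -sc -tb rmorphM !mulrA.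
Qed.

End Span.

Definition everything (T : Type) (_ : T) := True.

Lemma everythingM (S : pzRingType) (x z : S) :
  everything x -> everything z -> everything (x * z).
Proof. by []. Qed.

Definition left_fractions (R S : pzRingType) (f : {rmorphism R -> S}) :=
  forall s : S, has_denom f (@everything S) s.

(** If g and h agree on R, then
    g s = g s * h (Σ r x) = Σ g (s r) * h x = Σ h (s r) * h x = h s. *)
Lemma left_fractions_epi (R S : pzRingType) (f : {rmorphism R -> S}) :
  left_fractions f -> ring_epi f.
Proof.
move=> frac T g h gh s; rewrite -[LHS]mulr1 -(rmorph1 h) -[in RHS](mulr1 s).
elim: (frac s) => [|r x [r' sr'] _|u v _ hu _ hv].
- by rewrite mulr0 !rmorph0 mulr0.
- rewrite [in LHS]rmorphM mulrA -[h (f r)](gh r) -rmorphM /= sr'.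
  by rewrite [g _](gh r') /= -sr' !rmorphM mulrA.
- by rewrite mulrBr !rmorphB mulrBr hu hv.
Qed.

(** * Flatness from fractions *)

Lemma subrACA (V : zmodType) (a b c d : V) : (a - b) - (c - d) = (a - c) - (b - d).
Proof. by rewrite opprD addrACA -opprD. Qed.

Section Words.
Variables (R : pzRingType) (M : lmodType R^c) (N : lmodType R).
Implicit Types t u : {freeg (M * N)%type}.

(** Words are integral combinations of pure words, hence generated by them
    under subtraction. *)
Lemma word_ind (P : {freeg (M * N)%type} -> Prop) :
    P 0 -> (forall t u, P t -> P u -> P (t - u)) ->
    (forall x y, P (pure_word x y)) ->
  forall t, P t.
Proof.
move=> P0 PB Pw.
have PN t : P t -> P (- t) by move=> Pt; rewrite -sub0r; apply: PB.
have PD t u : P t -> P u -> P (t + u).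
  by move=> Pt Pu; rewrite -[u]opprK; apply: PB => //; apply: PN.
move=> t; rewrite -[t]freeg_sumE; apply: (big_rec P) => // -[x y] u _; apply: (PD).
have Pn n : P (<< (x, y) >> *+ n).
  by elim: n => [|n IH]; rewrite ?mulr0n // mulrS; apply: PD => //; apply: Pw.
rewrite -[X in << X *g _ >>]intz -freeg_mulz.
case: (coeff _ _) => n; first by rewrite -pmulrn; apply: Pn.
by rewrite NegzE mulrNz -pmulrn; apply/PN/Pn.
Qed.

Lemma tensor_nullN t : tensor_null t -> tensor_null (- t).
Proof. by move=> t0; rewrite -sub0r; apply: tensor_nullB t0; apply: tensor_null0. Qed.

Lemma tensor_nullD t u : tensor_null t -> tensor_null u -> tensor_null (t + u).
Proof. by move=> ? ?; rewrite -[u]opprK; apply: tensor_nullB => //; apply: tensor_nullN. Qed.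

Lemma tensor_null_pure0l y : tensor_null (pure_word (0 : M) y : {freeg (M * N)%type}).
Proof.
move: (tensor_nullDl (0 : M) 0 y); rewrite addr0 opprD addrA subrr sub0r.
by move/tensor_nullN; rewrite opprK.
Qed.

End Words.

(** Flatness becomes a statement about words, which are handled by
    [word_ind] and by induction on [tensor_null]. *)
Lemma tensor_map_injP (R : pzRingType) (M M' : lmodType R^c) (N N' : lmodType R)
    (f : {linear M -> M'}) (g : {linear N -> N'}) :
  injective (tensor_map f g) <->
  forall w, tensor_null (word_map f g w) -> tensor_null w.
Proof.
split=> [inj w w0|inj t u].
  rewrite -[w]subr0; apply/tensor_class_eq/inj.
  by rewrite !tensor_map_class; apply/tensor_class_eq; rewrite raddf0 subr0.
rewrite -[t]tensor_reprK -[u]tensor_reprK !tensor_map_class => /tensor_class_eq.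
by rewrite -raddfB => /inj ?; apply/tensor_class_eq.
Qed.

Section RightMul.
Variables (R S : pzRingType) (f : {rmorphism R -> S}) (y : S).

Definition right_mul (s : left_restr f) : left_restr f := (s : S) * y.

Lemma right_mul_linear : linear right_mul.
Proof.
move=> a u v; rewrite /right_mul [LHS]mulrDl; congr (_ + _).
by rewrite -[LHS]mulrA.
Qed.

HB.instance Definition _ :=
  GRing.isLinear.Build R (left_restr f) (left_restr f) *:%R right_mul right_mul_linear.

End RightMul.

Section Numerator.
Variables (R S : pzRingType) (f : {rmorphism R -> S}).
Hypothesis injf : injective f.

(** The junk value 0 away from denominators keeps numerators total, so that
    they can be evaluated on arbitrary words. *)
Definition numer (s : S) (r : R) : R :=
  if pselect (exists r', s * f r = f r') is left e then projT1 (cid e) else 0.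

Lemma numer_eq s r r' : s * f r = f r' -> numer s r = r'.
Proof.
move=> e; rewrite /numer; case: pselect => [e'|[]]; last by exists r'.
by apply: injf; case: cid => r'' /= <-.
Qed.

Hypothesis frac : left_fractions f.

Section Eval.
Variable M : lmodType R^c.
Implicit Types w : {freeg (M * left_restr f)%type}.

(** The right action of S on M ⊗ S, on words. *)
Definition word_act (y : S) w := word_map (idfun : {linear M -> M}) (@right_mul _ _ f y) w.

Lemma word_act_pure y m s : word_act y (pure_word m s) = pure_word m ((s : S) * y : left_restr f).
Proof. exact: word_map_pure. Qed.

Lemma word_act1 w : word_act 1 w = w.
Proof.
elim/word_ind: w => [|t u IHt IHu|m s]; first exact: raddf0.
  by rewrite /word_act raddfB [X in X - _]IHt [X in _ - X]IHu.
by rewrite word_act_pure mulr1.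
Qed.

Lemma word_actDr y z w :
  tensor_null (word_act (y + z) w - (word_act y w + word_act z w)).
Proof.
elim/word_ind: w => [|t u IHt IHu|m s].
- by rewrite /word_act !raddf0 addr0 subrr; apply: tensor_null0.
- rewrite /word_act !raddfB (addrACA (word_map _ _ _)) -opprD subrACA.
  exact: tensor_nullB.
- by rewrite !word_act_pure mulrDr; apply: tensor_nullDr.
Qed.

(** For a common denominator r of the right components of w, the element w * f r
    of M ⊗ S has the form m ⊗ 1; [eval_word r w] is this m. *)
Definition eval_word (r : R) w : M :=
  fglift (fun p : M * left_restr f => (numer p.2 r : R^c) *: p.1 : zmodule M) w.

Lemma eval_word_pure r m s : eval_word r (pure_word m s) = (numer s r : R^c) *: m.
Proof. by rewrite /eval_word liftU scale1r. Qed.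

Lemma eval_wordB r : zmod_morphism (eval_word r).
Proof. by move=> t u; rewrite /eval_word lift_is_additive. Qed.


HB.instance Definition _ r := GRing.isZmodMorphism.Build _ _ (eval_word r) (eval_wordB r).

(** The multiplier [a] and the extra factor [c] make the statement stable under
    refinement of covers, as the induction on [tensor_null] requires. *)
Lemma eval_word_null w : tensor_null w ->
  forall a, covers f (@everything S) (fun r => forall c, eval_word (a * r * c) w = 0).
Proof.
elim=> [m m' s|m s s'|m r s||{}w w' _ IH _ IH'] a.
- apply: covers_all => // r c.
  by rewrite raddfB raddfD /= !eval_word_pure scalerDr subrr.
- refine (covers_bind (@everythingM S) (frac (s * f a)) _) => r [b sb].
  apply: left_span_sub (frac (s' * f (a * r))) => r' [b' sb'] c.
  have e : s * f (a * (r * r') * c) = f (b * r' * c).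
    by rewrite !rmorphM -sb !mulrA.
  have e' : s' * f (a * (r * r') * c) = f (b' * c).
    by rewrite [RHS]rmorphM -sb' !rmorphM !mulrA.
  rewrite raddfB raddfD /= !eval_word_pure (numer_eq e) (numer_eq e').
  have -> : numer (s + s') (a * (r * r') * c) = b * r' * c + b' * c.
    by apply: numer_eq; rewrite rmorphD mulrDl e e'.
  by rewrite [X in X - _]scalerDl subrr.
- apply: left_span_sub (frac (s * f a)) => r' [b sb] c.
  have e : s * f (a * r' * c) = f (b * c).
    by rewrite [RHS]rmorphM -sb !rmorphM !mulrA.
  have -> : r *: s = (f r * (s : S)) :> S by [].
  have e' : f r * s * f (a * r' * c) = f (r * (b * c)).
    by rewrite -mulrA e -rmorphM.
  by rewrite raddfB /= !eval_word_pure (numer_eq e) (numer_eq e') scalerA subrr.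
- by apply: covers_all => // r c; rewrite raddf0.
- refine (covers_bind (@everythingM S) (IH a) _) => r wr.
  apply: left_span_sub (IH' (a * r)) => r' wr' c.
  by rewrite raddfB /= mulrA wr' -[_ * r' * c]mulrA wr subrr.
Qed.

(** On a cover of 1, w * (f r * x) equals m ⊗ x with m = [eval_word r w]. *)
Lemma word_act_eval w a : covers f (@everything S) (fun r => forall c x,
  tensor_null (word_act (f (a * r * c) * x) w -
               pure_word (eval_word (a * r * c) w) (x : left_restr f))).
Proof.
elim/word_ind: w a => [|t u IHt IHu|m s] a.
- apply: covers_all => // r c x; rewrite /word_act !raddf0 sub0r.
  exact/tensor_nullN/tensor_null_pure0l.
- refine (covers_bind (@everythingM S) (IHt a) _) => r tr.
  apply: left_span_sub (IHu (a * r)) => r' ur' c x.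
  move: (tensor_nullB (tr (r' * c) x) (ur' c x)); rewrite !mulrA.
  set d := a * r * r' * c; rewrite /word_act !raddfB /= => n1.
  have n2 := tensor_nullDl (eval_word d t - eval_word d u) (eval_word d u) (x : left_restr f).
  move: (tensor_nullD n1 n2); rewrite subrK.
  set X := word_map _ _ t; set Y := word_map _ _ u.
  set p := pure_word (eval_word d t) _; set q := pure_word (eval_word d u) _.
  set p' := pure_word _ _.
  rewrite -opprD.
  suff -> : X - p - (Y - q) + (p - (p' + q)) = X - Y - p' by [].
  by rewrite (subrACA X) -addrA; congr (_ + _); rewrite opprB addrA subrK opprD addrCA subrr addr0.
- apply: left_span_sub (frac (s * f a)) => r [b sb] c x.
  have e : s * f (a * r * c) = f (b * c).
    by rewrite [RHS]rmorphM -sb !rmorphM !mulrA.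
  rewrite word_act_pure eval_word_pure (numer_eq e) mulrA e.
  rewrite -opprB; apply: tensor_nullN; exact: tensor_nullZ.
Qed.

End Eval.

(** Let h be injective and let w vanish after applying h.  On a cover of 1,
    evaluation turns w into elements of M killed by h, hence into 0; so
    w * (f r * x) vanishes on that cover, and w, being the sum of these, vanishes. *)
Lemma left_fractions_flat : left_flat (left_restr f).
Proof.
move=> M M' h injh; apply/tensor_map_injP => w w0.
have evh r u : h (eval_word r u) = eval_word r (word_map h idfun u).
  elim/word_ind: u => [|t u IHt IHu|m s]; first by rewrite !raddf0.
    by rewrite !raddfB /= IHt IHu.
  by rewrite word_map_pure !eval_word_pure linearZ.
pose killed r := forall x, tensor_null (word_act (f r * x) w).
have : covers f (@everything S) killed.
  refine (covers_bind (@everythingM S) (eval_word_null w0 1) _) => r r0.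
  apply: left_span_sub (word_act_eval w r) => r' hr' x.
  move: (hr' 1 x); rewrite mulr1.
  have -> : eval_word (r * r') w = 0 by apply: injh; rewrite evh raddf0 -(r0 r') mul1r.
  move=> hx; rewrite -[word_act _ _](subrK (pure_word (0 : M) (x : left_restr f))).
  by apply/tensor_nullD/tensor_null_pure0l.
rewrite -[w]word_act1; elim=> [|r x kr _|s t _ hs _ ht].
- have := word_actDr 0 0 w; rewrite addr0 opprD addrA subrr sub0r.
  by move/tensor_nullN; rewrite opprK.
- exact: kr.
- have := tensor_nullB (tensor_nullB hs (word_actDr (s - t) t w)) ht.
  by rewrite subrK subKr addrK.
Qed.

End Numerator.

(** * Exchanging left and right *)

Section OppositeMorphism.
Variables (R S : pzRingType) (f : {rmorphism R -> S}).

Definition op_hom (r : R^c) : S^c := f r.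

Lemma op_hom_zmod : zmod_morphism op_hom.
Proof. exact: (rmorphB f). Qed.
Lemma op_hom_monoid : monoid_morphism op_hom.
Proof. by split=> [|x y]; [apply: (rmorph1 f)|apply: (rmorphM f)]. Qed.

HB.instance Definition _ := GRing.isZmodMorphism.Build R^c S^c op_hom op_hom_zmod.
HB.instance Definition _ := GRing.isMonoidMorphism.Build R^c S^c op_hom op_hom_monoid.

Definition op_morph : {rmorphism R^c -> S^c} := op_hom.

End OppositeMorphism.

Section OppositeEpi.
Variables (R S : pzRingType) (f : {rmorphism R -> S}).

Lemma op_hom_epi : ring_epi f -> ring_epi (op_morph f).
Proof.
move=> epi T g h gh s.
pose unop (k : {rmorphism S^c -> T}) : S -> T^c := k.
have uB k : zmod_morphism (unop k) by exact: (rmorphB k).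
have uM k : monoid_morphism (unop k).
  by split=> [|x y]; [apply: (rmorph1 k)|apply: (rmorphM k)].
pose gz := GRing.isZmodMorphism.Build S T^c (unop g) (uB g).
pose gm := GRing.isMonoidMorphism.Build S T^c (unop g) (uM g).
pose g' : {rmorphism S -> T^c} := HB.pack (unop g) gz gm.
pose hz := GRing.isZmodMorphism.Build S T^c (unop h) (uB h).
pose hm := GRing.isMonoidMorphism.Build S T^c (unop h) (uM h).
pose h' : {rmorphism S -> T^c} := HB.pack (unop h) hz hm.
exact: (epi _ g' h').
Qed.

End OppositeEpi.

Section OppositeModules.
Variable R : pzRingType.

(** The double converse of R is not convertible to R, so a module over one has
    to be relabelled to become a module over the other. *)
Definition op_module (N : lmodType R) : Type := N.
Definition unop_module (M : lmodType R^c^c) : Type := M.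

Section Instances.
Variables (N : lmodType R) (M : lmodType R^c^c).

HB.instance Definition _ := GRing.Zmodule.on (op_module N).
HB.instance Definition _ := GRing.Zmodule.on (unop_module M).

Definition op_scale (r : R^c^c) (n : op_module N) : op_module N := (r : R) *: (n : N).
Definition unop_scale (r : R) (m : unop_module M) : unop_module M := (r : R^c^c) *: (m : M).

Lemma op_scaleA a b v : op_scale a (op_scale b v) = op_scale (a * b) v.
Proof. exact: (@scalerA R N). Qed.
Lemma op_scale1 : left_id 1 op_scale.
Proof. exact: (@scale1r R N). Qed.
Lemma op_scaleDr : right_distributive op_scale +%R.
Proof. by move=> a u v; apply: (@scalerDr R N). Qed.
Lemma op_scaleDl v : {morph op_scale^~ v : a b / a + b}.
Proof. by move=> a b; apply: (@scalerDl R N). Qed.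

HB.instance Definition _ := GRing.Zmodule_isLmodule.Build R^c^c (op_module N)
  op_scaleA op_scale1 op_scaleDr op_scaleDl.

Lemma unop_scaleA a b v : unop_scale a (unop_scale b v) = unop_scale (a * b) v.
Proof. exact: (@scalerA R^c^c M). Qed.
Lemma unop_scale1 : left_id 1 unop_scale.
Proof. exact: (@scale1r R^c^c M). Qed.
Lemma unop_scaleDr : right_distributive unop_scale +%R.
Proof. by move=> a u v; apply: (@scalerDr R^c^c M). Qed.
Lemma unop_scaleDl v : {morph unop_scale^~ v : a b / a + b}.
Proof. by move=> a b; apply: (@scalerDl R^c^c M). Qed.

HB.instance Definition _ := GRing.Zmodule_isLmodule.Build R (unop_module M)
  unop_scaleA unop_scale1 unop_scaleDr unop_scaleDl.

End Instances.

Definition op_map (N N' : lmodType R) (g : {linear N -> N'}) :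
  op_module N -> op_module N' := g.
Lemma op_map_linear N N' g : linear (@op_map N N' g).
Proof. exact: (linearP g). Qed.
HB.instance Definition _ N N' g := GRing.isLinear.Build R^c^c (op_module N) (op_module N')
  *:%R (@op_map N N' g) (@op_map_linear N N' g).
Definition op_linear N N' g : {linear op_module N -> op_module N'} := @op_map N N' g.

Definition unop_map (M M' : lmodType R^c^c) (g : {linear M -> M'}) :
  unop_module M -> unop_module M' := g.
Lemma unop_map_linear M M' g : linear (@unop_map M M' g).
Proof. exact: (linearP g). Qed.
HB.instance Definition _ M M' g := GRing.isLinear.Build R (unop_module M) (unop_module M')
  *:%R (@unop_map M M' g) (@unop_map_linear M M' g).
Definition unop_linear M M' g : {linear unop_module M -> unop_module M'} := @unop_map M M' g.

End OppositeModules.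

(** Exchanging the two factors of a tensor product exchanges left and right
    modules.  In its uses [u] and [v] are identities between types that carry
    the same group with different module structures. *)
Section Swap.
Variables (R R' : pzRingType) (rho : R -> R').
Variables (M : lmodType R^c) (N : lmodType R).
Variables (M' : lmodType R'^c) (N' : lmodType R').
Variables (u : N -> M') (v : M -> N').

Definition word_swap : {freeg (M * N)%type} -> {freeg (M' * N')%type} :=
  fglift (fun p : M * N => pure_word (u p.2) (v p.1)).

Lemma word_swap_pure m n : word_swap (pure_word m n) = pure_word (u n) (v m).
Proof. by rewrite /word_swap liftU scale1r. Qed.

Lemma word_swapB : zmod_morphism word_swap.
Proof. by move=> t t'; rewrite /word_swap lift_is_additive. Qed.

HB.instance Definition _ := GRing.isZmodMorphism.Build
  {freeg (M * N)%type} {freeg (M' * N')%type} word_swap word_swapB.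

Hypothesis uD : {morph u : x y / x + y}.
Hypothesis vD : {morph v : x y / x + y}.
Hypothesis uZ : forall r n, u (r *: n) = (rho r : R'^c) *: u n.
Hypothesis vZ : forall r m, v ((r : R^c) *: m) = rho r *: v m.

Lemma word_swap_null w : tensor_null w -> tensor_null (word_swap w).
Proof.
elim=> [x x' y|x y y'|x r y||{}t t' _ IHt _ IHu].
- by rewrite raddfB raddfD /= !word_swap_pure vD; apply: tensor_nullDr.
- by rewrite raddfB raddfD /= !word_swap_pure uD; apply: tensor_nullDl.
- rewrite raddfB /= !word_swap_pure uZ vZ -opprB; apply: tensor_nullN.
  exact: tensor_nullZ.
- by rewrite raddf0; apply: tensor_null0.
- by rewrite raddfB; apply: tensor_nullB.
Qed.

End Swap.

Section FlatOpposite.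
Variables (R S : pzRingType) (f : {rmorphism R -> S}).

Lemma left_flat_op : left_flat (left_restr (op_morph f)) -> right_flat (right_restr f).
Proof.
move=> flat N N' g injg; apply/tensor_map_injP => w w0.
have /tensor_map_injP flat' := flat _ _ (op_linear g) injg.
pose to (X : lmodType R) :=
  @word_swap R R^c (right_restr f) X (op_module X) (left_restr (op_morph f)) id id.
pose of_ (X : lmodType R) :=
  @word_swap R^c R (op_module X) (left_restr (op_morph f)) (right_restr f) X id id.
have toK X : cancel (to X) (of_ X).
  elim/word_ind => [|t t' IHt IHt'|m n].
  - by rewrite /to /of_ !raddf0.
  - by move: IHt IHt'; rewrite /to /of_ !raddfB /= => -> ->.
  - by rewrite /to /of_ !word_swap_pure.
have to_map t : to N' (word_map idfun g t) = word_map (op_linear g) idfun (to N t).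
  elim/word_ind: t => [|t t' IHt IHt'|m n].
  - by rewrite /to !raddf0.
  - by move: IHt IHt'; rewrite /to !raddfB /= => -> ->.
  - by rewrite word_map_pure /to !word_swap_pure word_map_pure.
rewrite -[w]toK; apply: (@word_swap_null R^c R id); try by [].
apply: flat'; rewrite -to_map.
exact: (@word_swap_null R R^c id).
Qed.

Lemma right_flat_op : right_flat (right_restr f) -> left_flat (left_restr (op_morph f)).
Proof.
move=> flat M M' g injg; apply/tensor_map_injP => w w0.
have /tensor_map_injP flat' := flat _ _ (unop_linear g) injg.
pose to (X : lmodType R^c^c) :=
  @word_swap R^c R X (left_restr (op_morph f)) (right_restr f) (unop_module X) id id.
pose of_ (X : lmodType R^c^c) :=
  @word_swap R R^c (right_restr f) (unop_module X) X (left_restr (op_morph f)) id id.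
have toK X : cancel (to X) (of_ X).
  elim/word_ind => [|t t' IHt IHt'|m n].
  - by rewrite /to /of_ !raddf0.
  - by move: IHt IHt'; rewrite /to /of_ !raddfB /= => -> ->.
  - by rewrite /to /of_ !word_swap_pure.
have to_map t : to M' (word_map g idfun t) = word_map idfun (unop_linear g) (to M t).
  elim/word_ind: t => [|t t' IHt IHt'|m n].
  - by rewrite /to !raddf0.
  - by move: IHt IHt'; rewrite /to !raddfB /= => -> ->.
  - by rewrite word_map_pure /to !word_swap_pure word_map_pure.
rewrite -[w]toK; apply: (@word_swap_null R R^c id); try by [].
apply: flat'; rewrite -to_map.
exact: (@word_swap_null R^c R id).
Qed.

End FlatOpposite.

(** * Fractions from flat epimorphisms *)

Section RightEndomorphisms.
Variable V : zmodType.

Definition additiveb : {pred V -> V} := fun g => `[< {morph g : x y / x + y} >].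

Lemma additiveb_closed : zmod_closed additiveb.
Proof.
split=> [|g h /asboolP gD /asboolP hD]; apply/asboolP => x y.
  by rewrite addr0.
by rewrite !fctE gD hD opprD addrACA.
Qed.

HB.instance Definition _ := GRing.isZmodClosed.Build (V -> V) additiveb additiveb_closed.

(** The endomorphism ring of an abelian group acting on the right, so that a
    right S-module V is a ring morphism from S to [right_end V]. *)
Record right_end := RightEnd { end_fun : V -> V; end_funP : end_fun \in additiveb }.

HB.instance Definition _ := [isSub for end_fun].
HB.instance Definition _ := [Choice of right_end by <:].
HB.instance Definition _ := [SubChoice_isSubZmodule of right_end by <:].

Definition end_one := RightEnd (introT (asboolP _) (fun x y : V => erefl (x + y))).

Lemma end_mul_subproof (g h : right_end) : end_fun h \o end_fun g \in additiveb.
Proof.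
case: g h => [g /asboolP gD] [h /asboolP hD] /=; apply/asboolP => x y /=.
by rewrite gD hD.
Qed.

Definition end_mul g h := RightEnd (end_mul_subproof g h).

Lemma end_eq (g h : right_end) : end_fun g =1 end_fun h -> g = h.
Proof. by move=> gh; apply: val_inj; apply: funext. Qed.

Lemma end_mulA : associative end_mul. Proof. by move=> g h k; apply: end_eq. Qed.
Lemma end_mul1l : left_id end_one end_mul. Proof. by move=> g; apply: end_eq. Qed.
Lemma end_mul1r : right_id end_one end_mul. Proof. by move=> g; apply: end_eq. Qed.
Lemma end_mulDl : left_distributive end_mul +%R.
Proof.
move=> g h [k kP]; apply: end_eq => x.
by move/asboolP: (kP) => kD; apply: kD.
Qed.
Lemma end_mulDr : right_distributive end_mul +%R.
Proof. by move=> g h k; apply: end_eq. Qed.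

HB.instance Definition _ := GRing.Zmodule_isPzRing.Build right_end
  end_mulA end_mul1l end_mul1r end_mulDl end_mulDr.

End RightEndomorphisms.

(** Along a ring epimorphism, an R-linear map between right S-modules is
    S-linear.  The R-linear map [phi] from S to Y defines the automorphism
    (x, y) |-> (x, phi x + y) of S * Y.  Conjugating the action of S on S * Y by
    it gives a second action, which agrees with the first one on R, hence on S. *)
Section EpiLinear.
Variables (R S : pzRingType) (f : {rmorphism R -> S}).
Hypothesis epif : ring_epi f.
Variables (Y : zmodType) (act : Y -> S -> Y).
Hypothesis actDl : forall s, {morph act^~ s : y z / y + z}.
Hypothesis actDr : forall y, {morph act y : s t / s + t}.
Hypothesis actA : forall y s t, act y (s * t) = act (act y s) t.
Hypothesis act1 : forall y, act y 1 = y.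
Variable phi : S -> Y.
Hypothesis phiD : {morph phi : x y / x + y}.
Hypothesis phif : forall x r, phi (x * f r) = act (phi x) (f r).

Definition diag_act (s : S) (p : S * Y) : S * Y := (p.1 * s, act p.2 s).
Definition sheared_act (s : S) (p : S * Y) : S * Y :=
  (p.1 * s, phi (p.1 * s) + act (p.2 - phi p.1) s).

Lemma diag_act_subproof s : diag_act s \in @additiveb (S * Y)%type.
Proof.
apply/asboolP => -[x y] [x' y']; rewrite /diag_act /=.
by apply: injective_projections; rewrite /= ?mulrDl ?actDl.
Qed.

Lemma sheared_act_subproof s : sheared_act s \in @additiveb (S * Y)%type.
Proof.
apply/asboolP => -[x y] [x' y']; rewrite /sheared_act /=.
apply: injective_projections => /=; first by rewrite mulrDl.
by rewrite mulrDl !phiD [RHS]addrACA -actDl opprD (addrACA y).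
Qed.

Definition diag_end s := RightEnd (diag_act_subproof s).
Definition sheared_end s := RightEnd (sheared_act_subproof s).

Let actB y s t : act y (s - t) = act y s - act y t.
Proof. by rewrite -[in RHS](subrK t s) [in RHS]actDr addrK. Qed.

Let phiB x y : phi (x - y) = phi x - phi y.
Proof. by rewrite -[in RHS](subrK y x) [in RHS]phiD addrK. Qed.

Lemma diag_end_zmod : zmod_morphism diag_end.
Proof.
move=> s t; apply: end_eq => -[x y]; rewrite /= /diag_act /=.
by apply: injective_projections; rewrite /= ?mulrBr ?actB.
Qed.

Lemma diag_end_monoid : monoid_morphism diag_end.
Proof.
split=> [|s t]; apply: end_eq => -[x y]; rewrite /= /diag_act /=.
  by rewrite mulr1 act1.
by rewrite mulrA actA.
Qed.

Lemma sheared_end_zmod : zmod_morphism sheared_end.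
Proof.
move=> s t; apply: end_eq => -[x y]; rewrite /= /sheared_act /=.
by apply: injective_projections; rewrite /= ?mulrBr // actB phiB [LHS]addrACA -opprD.
Qed.

Lemma sheared_end_monoid : monoid_morphism sheared_end.
Proof.
split=> [|s t]; apply: end_eq => -[x y]; rewrite /= /sheared_act /=.
  by rewrite mulr1 act1 addrC subrK.
by rewrite mulrA actA [phi (x * s) + _]addrC addrK.
Qed.

HB.instance Definition _ := GRing.isZmodMorphism.Build
  S (right_end (S * Y)%type) diag_end diag_end_zmod.
HB.instance Definition _ := GRing.isMonoidMorphism.Build
  S (right_end (S * Y)%type) diag_end diag_end_monoid.
HB.instance Definition _ := GRing.isZmodMorphism.Build
  S (right_end (S * Y)%type) sheared_end sheared_end_zmod.
HB.instance Definition _ := GRing.isMonoidMorphism.Build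
  S (right_end (S * Y)%type) sheared_end sheared_end_monoid.

Lemma epi_linear x : phi x = act (phi 1) x.
Proof.
have act0 s : act 0 s = 0.
  by apply: (addrI (act 0 s)); rewrite -actDl !addr0.
have /epif/(_ x) : (diag_end : {rmorphism _ -> _}) \o f =1 (sheared_end : {rmorphism _ -> _}) \o f.
  move=> r; apply: end_eq => -[s y]; rewrite /= /diag_act /sheared_act /= phif.
  by rewrite -actDl addrC subrK.
move/(congr1 (fun e => (end_fun e (1, phi 1)).2)).
by rewrite /= subrr act0 addr0 mul1r.
Qed.

End EpiLinear.

Section EpiTensor.
Variables (R S : pzRingType) (f : {rmorphism R -> S}).
Hypothesis epif : ring_epi f.

Let Y := tensor (right_restr f) (left_restr f).
Let act (t : Y) (s : S) : Y := tensor_map idfun (@right_mul _ _ f s) t.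

Let act_class w s : act (tensor_class w) s = tensor_class (word_act s w).
Proof. exact: tensor_map_class. Qed.

Lemma tensor_classD (M : lmodType R^c) (N : lmodType R) :
  {morph (@tensor_class _ M N) : x y / x + y}.
Proof. exact: raddfD. Qed.

(** The map x |-> x ⊗ 1 is R-linear for the right S-module structure of
    S ⊗ S, hence S-linear, and so takes s to (1 ⊗ 1) s. *)
Lemma epi_tensor_swap (s : S) :
  pure_tensor (s : right_restr f) (1 : left_restr f) =
  pure_tensor (1 : right_restr f) (s : left_restr f).
Proof.
pose phi (x : S) : Y := pure_tensor (x : right_restr f) (1 : left_restr f).
rewrite -/(phi s) (@epi_linear _ _ f epif _ act).
- by rewrite /act tensor_map_pure; congr pure_tensor; apply: mul1r.
- move=> x t u; rewrite -[t]tensor_reprK -[u]tensor_reprK -tensor_classD !act_class.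
  by rewrite /word_act raddfD tensor_classD.
- move=> t x y; rewrite -[t]tensor_reprK !act_class -tensor_classD.
  by apply/tensor_class_eq; apply: word_actDr.
- move=> t x y; rewrite -[t]tensor_reprK !act_class; congr tensor_class.
  elim/word_ind: (tensor_repr t) => [|w w' IH IH'|m n].
  + by rewrite /word_act !raddf0.
  + by move: IH IH'; rewrite /word_act !raddfB /= => -> ->.
  + by rewrite !word_act_pure mulrA.
- by move=> t; rewrite -[t]tensor_reprK act_class word_act1.
- by move=> x y; rewrite -tensor_classD; apply/tensor_class_eq; apply: tensor_nullDl.
- move=> x r; rewrite /act tensor_map_pure; apply/tensor_class_eq.
  have := tensor_nullZ (x : right_restr f) r (1 : left_restr f).
  suff -> : r *: (1 : left_restr f) = right_mul (f r) (1 : left_restr f) by [].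
  by rewrite /right_mul mul1r; apply: mulr1.
Qed.

End EpiTensor.

Section FlatFractions.
Variables (R S : pzRingType) (f : {rmorphism R -> S}).

Section Submodule.
Variable s : S.

Definition adjoin_pred : {pred right_restr f} :=
  fun x => `[< exists r r', x = s * f r + f r' :> S >].

Lemma adjoin_predP : submod_closed adjoin_pred.
Proof.
split=> [|a x y /asboolP[r [r' ->]] /asboolP[q [q' ->]]]; apply/asboolP.
  by exists 0, 0; rewrite rmorph0 mulr0 addr0.
exists (r * (a : R) + q), (r' * (a : R) + q').
rewrite !rmorphD !rmorphM mulrDr addrACA mulrA; congr (_ + _).
exact: mulrDl.
Qed.

HB.instance Definition _ := GRing.isSubmodClosed.Build R^c (right_restr f) adjoin_pred adjoin_predP.

(** The right R-submodule s f R + f R of S. *)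
Record adjoin := Adjoin { adjoin_val : right_restr f; adjoinP : adjoin_val \in adjoin_pred }.

HB.instance Definition _ := [isSub for adjoin_val].
HB.instance Definition _ := [Choice of adjoin by <:].
HB.instance Definition _ := [SubChoice_isSubLmodule of adjoin by <:].

Definition adjoin_incl : {linear adjoin -> right_restr f} := val.

Lemma adjoin_1P : (1 : right_restr f) \in adjoin_pred.
Proof. by apply/asboolP; exists 0, 1; rewrite rmorph0 mulr0 add0r rmorph1. Qed.

Lemma adjoin_sP : (s : right_restr f) \in adjoin_pred.
Proof. by apply/asboolP; exists 1, 0; rewrite rmorph0 rmorph1 mulr1 addr0. Qed.

(** The coefficient r in x = s * f r + f r'; it is determined by x only up to
    the denominators of s ([slope_denom]). *)
Definition slope (x : adjoin) : R :=
  projT1 (cid (elimT (asboolP _) (adjoinP x))).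

Lemma slopeP x : exists r', adjoin_val x = s * f (slope x) + f r' :> S.
Proof. by rewrite /slope; case: cid. Qed.

Lemma slope_denom x r t : adjoin_val x = s * f r + f t :> S -> denom f s (slope x - r).
Proof.
have [q ->] := slopeP x => e; exists (t - q).
rewrite !rmorphB mulrBr; apply: (addIr (s * f r)); rewrite subrK.
by rewrite addrAC [f t + _]addrC -e addrK.
Qed.

Definition slope_word (w : {freeg (adjoin * left_restr f)%type}) : S :=
  fglift (fun p : adjoin * left_restr f => f (slope p.1) * p.2 : zmodule S) w.

Lemma slope_word_pure x y : slope_word (pure_word x y) = f (slope x) * y.
Proof. by rewrite /slope_word liftU scale1r. Qed.

Lemma slope_wordB : zmod_morphism slope_word.
Proof. by move=> t u; rewrite /slope_word lift_is_additive. Qed.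

HB.instance Definition _ := GRing.isZmodMorphism.Build _ _ slope_word slope_wordB.

(** Modulo the right ideal of S generated by the denominators of s, sending
    x ⊗ y to f (slope x) * y is well defined on the tensor product. *)
Lemma slope_word_null w : tensor_null w -> left_span f (@everything S) (denom f s) (slope_word w).
Proof.
elim=> [x x' y|x y y'|x r y||{}t u _ IHt _ IHu].
- rewrite raddfB raddfD /= !slope_word_pure -mulrDl -mulrBl -rmorphD -rmorphB.
  apply: left_span_gen => //.
  have [q e] := slopeP x; have [q' e'] := slopeP x'.
  apply: (@slope_denom _ _ (q + q')); rewrite !rmorphD mulrDr addrACA -e -e'.
  by [].
- by rewrite raddfB raddfD /= !slope_word_pure [X in X - _]mulrDr subrr; apply: left_span0.
- rewrite raddfB /= !slope_word_pure [r *: y]/(f r * (y : S)) mulrA -rmorphM -mulrBl -rmorphB.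
  apply: left_span_gen => //; have [q e] := slopeP x.
  by apply: (@slope_denom _ _ (q * r)); rewrite !rmorphM mulrA -mulrDl -e.
- by rewrite raddf0; apply: left_span0.
- by rewrite raddfB; apply: left_spanB.
Qed.

End Submodule.

(** Flatness lets s ⊗ 1 = 1 ⊗ s descend from S ⊗ S to [adjoin s] ⊗ S; there the
    slopes of s and 1 are 1 and 0 up to denominators, which puts 1 in the right
    ideal generated by the denominators of s. *)
Lemma flat_epi_left_fractions : left_flat (left_restr f) -> ring_epi f -> left_fractions f.
Proof.
move=> flat epif s.
have /tensor_map_injP := flat _ _ (adjoin_incl s) (@val_inj _ _ _).
pose s1 : adjoin s := Adjoin (adjoin_sP s); pose e1 : adjoin s := Adjoin (adjoin_1P s).
move/(_ (pure_word s1 (1 : left_restr f) - pure_word e1 (s : left_restr f))).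
rewrite raddfB /= !word_map_pure.
move=> inj; have /inj/slope_word_null : tensor_null
    (pure_word (s : right_restr f) (1 : left_restr f) -
     pure_word (1 : right_restr f) (s : left_restr f)).
  by apply/tensor_class_eq; apply: epi_tensor_swap.
 rewrite raddfB /= !slope_word_pure mulr1 => h.
have d1 : denom f s (slope s1 - 1).
  by apply: (@slope_denom _ _ _ 0); rewrite rmorph0 rmorph1 mulr1 addr0.
have d0 : denom f s (slope e1 - 0).
  by apply: (@slope_denom _ _ _ 1); rewrite rmorph0 rmorph1 mulr0 add0r.
have g1 := left_span_gen f d1 (I : everything 1).
have g0 := left_span_gen f d0 (I : everything s).
move: (left_spanB (left_spanD h g0) g1); rewrite subr0 subrK rmorphB mulr1 rmorph1 subKr.
exact.
Qed.

End FlatFractions.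

(** * Germs of module maps on dense right ideals *)

Section Germs.
Variable R : pzRingType.
Implicit Types (D : R -> Prop) (phi psi : R -> R) (a b c x y : R).

(** [dense_meets] is density in the sense of Utumi.  It makes dense right ideals
    closed under intersection and under preimage by a linear map, and keeps a
    dense ideal from being annihilated by a nonzero element. *)
Record dense D : Prop := Dense {
  dense0 : D 0;
  denseD : forall x y, D x -> D y -> D (x + y);
  denseM : forall x c, D x -> D (x * c);
  dense_meets : forall a b, b != 0 -> exists2 r, D (a * r) & b * r != 0 }.

Definition nearly (P : R -> Prop) := exists2 D, dense D & forall x, D x -> P x.

Lemma denseT : dense (@everything R).
Proof. by split=> // a b b0; exists 1; rewrite ?mulr1. Qed.

Lemma denseI D D' : dense D -> dense D' -> dense (fun x => D x /\ D' x).
Proof.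
move=> [D0 DD DM Dr] [D0' DD' DM' Dr']; split=> // [x y [? ?] [? ?]|x c [? ?]|a b b0].
- by split; [apply: DD|apply: DD'].
- by split; [apply: DM|apply: DM'].
have [r ar br] := Dr a b b0; have [r' ar' br'] := Dr' (a * r) (b * r) br.
exists (r * r'); last by rewrite mulrA.
by rewrite mulrA; split=> //; apply: DM.
Qed.

Lemma nearlyT P : (forall x, P x) -> nearly P.
Proof. by move=> ?; exists (@everything R) => //; apply: denseT. Qed.

Lemma nearly_sub P P' : (forall x, P x -> P' x) -> nearly P -> nearly P'.
Proof. by move=> sub [D dD DP]; exists D => // x /DP /sub. Qed.

Lemma nearlyI P P' : nearly P -> nearly P' -> nearly (fun x => P x /\ P' x).
Proof.
move=> [D dD DP] [D' dD' DP']; exists (fun x => D x /\ D' x); first exact: denseI.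
by move=> x [/DP ? /DP' ?].
Qed.

Lemma nearly_annihilator b : nearly (fun x => b * x = 0) -> b = 0.
Proof.
case=> D dD D0; apply/eqP/negP => /negP/(dense_meets dD 1) [r].
by rewrite mul1r => /D0 ->; rewrite eqxx.
Qed.

Record linear_on D phi : Prop := LinearOn {
  linear_onD : forall x y, D x -> D y -> phi (x + y) = phi x + phi y;
  linear_onM : forall x c, D x -> phi (x * c) = phi x * c }.

(** A map defined on a dense right ideal is extended arbitrarily to R: pointwise
    operations are then total, and only their germs matter. *)
Definition partial_map phi := exists2 D, dense D & linear_on D phi.

Lemma linear_on0 D phi : dense D -> linear_on D phi -> phi 0 = 0.
Proof. by move=> dD [_ pM]; rewrite -(mulr0 0) pM ?mulr0 //; apply: dense0. Qed.

(** A multiple by [a] is first moved into [D], then its image is moved into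
    [D']. *)
Lemma dense_preim D D' phi : dense D -> linear_on D phi -> dense D' ->
  dense (fun x => D x /\ D' (phi x)).
Proof.
move=> dD lphi dD'; split.
- by split; [apply: dense0|rewrite (linear_on0 dD lphi); apply: dense0].
- move=> x y [Dx Dx'] [Dy Dy']; split; first exact: denseD.
  by rewrite (linear_onD lphi) //; apply: denseD.
- move=> x c [Dx Dx']; split; first exact: denseM.
  by rewrite (linear_onM lphi) //; apply: denseM.
move=> a b b0; have [r ar br] := dense_meets dD a b0.
have [r' ar' br'] := dense_meets dD' (phi (a * r)) br.
exists (r * r'); rewrite mulrA //; split; first exact: denseM.
by rewrite (linear_onM lphi).
Qed.

Lemma nearly_preim P phi : partial_map phi -> nearly P -> nearly (fun x => P (phi x)).
Proof.
move=> [D dD lphi] [D' dD' DP]; exists (fun x => D x /\ D' (phi x)).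
  exact: dense_preim.
by move=> x [_ /DP].
Qed.

Lemma partial_map_comp phi psi : partial_map phi -> partial_map psi -> partial_map (phi \o psi).
Proof.
move=> [D dD lphi] [D' dD' lpsi]; exists (fun x => D' x /\ D (psi x)).
  exact: dense_preim.
split=> [x y [Dx Dx'] [Dy Dy']|x c [Dx Dx']] /=.
  by rewrite (linear_onD lpsi) // (linear_onD lphi).
by rewrite (linear_onM lpsi) // (linear_onM lphi).
Qed.

Lemma partial_map_mull a : partial_map (fun x => a * x).
Proof.
exists (@everything R); first exact: denseT.
by split=> [x y _ _|x c _]; rewrite ?mulrDr ?mulrA.
Qed.

Definition partial_mapb : {pred R -> R} := fun phi => `[< partial_map phi >].

Lemma partial_mapb_closed : zmod_closed partial_mapb.
Proof.
split=> [|phi psi /asboolP[D dD lphi] /asboolP[D' dD' lpsi]]; apply/asboolP.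
  exists (@everything R); first exact: denseT.
  by split=> [x y _ _|x c _]; rewrite ?addr0 ?mul0r.
exists (fun x => D x /\ D' x); first exact: denseI.
split=> [x y [Dx Dx'] [Dy Dy']|x c [Dx Dx']]; rewrite !fctE.
  by rewrite (linear_onD lphi) // (linear_onD lpsi) // opprD addrACA.
by rewrite (linear_onM lphi) // (linear_onM lpsi) // mulrBl.
Qed.

HB.instance Definition _ := GRing.isZmodClosed.Build (R -> R) partial_mapb partial_mapb_closed.

Record pmap := PMap { pmap_fun :> R -> R; pmap_funP : pmap_fun \in partial_mapb }.

HB.instance Definition _ := [isSub for pmap_fun].
HB.instance Definition _ := [Choice of pmap by <:].
HB.instance Definition _ := [SubChoice_isSubZmodule of pmap by <:].

Lemma pmapP (phi : pmap) : partial_map phi.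
Proof. exact/asboolP/pmap_funP. Qed.

Lemma pmapB (phi psi : pmap) x : (phi - psi) x = phi x - psi x.
Proof. by []. Qed.

Definition germ_null : {pred pmap} := fun phi : pmap => `[< nearly (fun x => phi x = 0) >].

Lemma germ_null_closed : zmod_closed germ_null.
Proof.
split=> [|phi psi /asboolP p0 /asboolP q0]; apply/asboolP.
  exact: nearlyT.
apply: nearly_sub (nearlyI p0 q0) => x [px qx].
by rewrite pmapB px qx subr0.
Qed.

HB.instance Definition _ := GRing.isZmodClosed.Build pmap germ_null germ_null_closed.

Definition germ : Type := Quotient.quot (germ_null : zmodClosed _).
HB.instance Definition _ := GRing.Zmodule.on germ.

Definition germ_of (phi : pmap) : germ :=
  \pi_(Quotient.quot (germ_null : zmodClosed _)) phi.

Definition germ_repr (q : germ) : pmap :=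
  @repr _ (Quotient.quot (germ_null : zmodClosed _)) q.

Lemma germ_reprK : cancel germ_repr germ_of.
Proof. exact: reprK. Qed.

Lemma germ_eqP (phi psi : pmap) :
  germ_of phi = germ_of psi <-> nearly (fun x => phi x = psi x).
Proof.
rewrite /germ_of; split=> [/eqP|h].
  rewrite -Quotient.idealrBE => /asboolP; apply: nearly_sub => x.
  by move/eqP; rewrite pmapB subr_eq0 => /eqP.
apply/eqP; rewrite -Quotient.idealrBE; apply/asboolP; apply: nearly_sub h => x.
by rewrite pmapB => ->; rewrite subrr.
Qed.

Lemma germ_ofB : zmod_morphism germ_of.
Proof. exact: (raddfB (\pi_(Quotient.quot (germ_null : zmodClosed _)))). Qed.
Lemma germ_ofD : {morph germ_of : x y / x + y}.
Proof. exact: (raddfD (\pi_(Quotient.quot (germ_null : zmodClosed _)))). Qed.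

Lemma pmap_comp_subproof (phi psi : pmap) : (phi : R -> R) \o psi \in partial_mapb.
Proof. by apply/asboolP; apply: partial_map_comp; apply: pmapP. Qed.

Definition pmap_comp (phi psi : pmap) := PMap (pmap_comp_subproof phi psi).

Lemma pmap_mull_subproof a : (fun x => a * x) \in partial_mapb.
Proof. by apply/asboolP; apply: partial_map_mull. Qed.

Definition pmap_mull a := PMap (pmap_mull_subproof a).

Definition germ_mul (p q : germ) : germ :=
  germ_of (pmap_comp (germ_repr p) (germ_repr q)).

Lemma germ_mulE (phi psi : pmap) :
  germ_mul (germ_of phi) (germ_of psi) = germ_of (pmap_comp phi psi).
Proof.
have /germ_eqP e := germ_reprK (germ_of phi).
have /germ_eqP e' := germ_reprK (germ_of psi).
apply/germ_eqP; apply: nearly_sub (nearlyI e' (nearly_preim (pmapP psi) e)) => x /=.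
by case=> -> ->.
Qed.

Definition germ_in a : germ := germ_of (pmap_mull a).

Lemma germ_ind (P : germ -> Prop) : (forall phi : pmap, P (germ_of phi)) -> forall q, P q.
Proof. by move=> h q; rewrite -[q]germ_reprK. Qed.

Lemma germ_mulA : associative germ_mul.
Proof.
elim/germ_ind=> p; elim/germ_ind=> q; elim/germ_ind=> r.
by rewrite !germ_mulE; apply/germ_eqP/nearlyT.
Qed.

Lemma germ_mul1l : left_id (germ_in 1) germ_mul.
Proof.
elim/germ_ind=> p; rewrite germ_mulE; apply/germ_eqP/nearlyT => x /=.
by rewrite mul1r.
Qed.

Lemma germ_mul1r : right_id (germ_in 1) germ_mul.
Proof.
elim/germ_ind=> p; rewrite germ_mulE; apply/germ_eqP/nearlyT => x /=.
by rewrite mul1r.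
Qed.

Lemma germ_mulDl : left_distributive germ_mul +%R.
Proof.
elim/germ_ind=> p; elim/germ_ind=> q; elim/germ_ind=> r.
by rewrite -germ_ofD !germ_mulE -germ_ofD; apply/germ_eqP/nearlyT.
Qed.

(** The one ring axiom that fails for arbitrary functions: it holds where the
    values of [q] and [r] both lie in the domain of linearity of [p]. *)
Lemma germ_mulDr : right_distributive germ_mul +%R.
Proof.
elim/germ_ind=> p; elim/germ_ind=> q; elim/germ_ind=> r.
rewrite -germ_ofD !germ_mulE -germ_ofD; apply/germ_eqP.
have [D dD lp] := pmapP p.
have nD : nearly D by exists D.
have := nearlyI (nearly_preim (pmapP q) nD) (nearly_preim (pmapP r) nD).
by apply: nearly_sub => x [Dq Dr]; apply: (linear_onD lp).
Qed.

HB.instance Definition _ := GRing.Zmodule_isPzRing.Build germ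
  germ_mulA germ_mul1l germ_mul1r germ_mulDl germ_mulDr.

Lemma germ_inB : zmod_morphism germ_in.
Proof.
move=> a b; rewrite /germ_in -germ_ofB; apply/germ_eqP/nearlyT => x.
exact: mulrBl.
Qed.

Lemma germ_inM : monoid_morphism germ_in.
Proof.
split=> // a b; rewrite [RHS]germ_mulE; apply/germ_eqP/nearlyT => x /=.
by rewrite mulrA.
Qed.

HB.instance Definition _ := GRing.isZmodMorphism.Build R germ germ_in germ_inB.
HB.instance Definition _ := GRing.isMonoidMorphism.Build R germ germ_in germ_inM.

Lemma germ_in_inj : injective germ_in.
Proof.
move=> a b /germ_eqP ab; apply/eqP; rewrite -subr_eq0; apply/eqP.
apply: nearly_annihilator; apply: nearly_sub ab => x /= ab.
by rewrite mulrBl ab subrr.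
Qed.

End Germs.

Section Embedding.
Variables (R S : pzRingType) (f : {rmorphism R -> S}).
Hypothesis injf : injective f.
Hypothesis frac : left_fractions f.

(** Let b be nonzero.  The denominators of s * f a cover 1; if b killed all of
    them, then b would kill 1. *)
Lemma denom_dense s : dense (denom f s).
Proof.
split=> [|x y [x' ex] [y' ey]|x c [x' ex]|a b b0].
- by exists 0; rewrite !rmorph0 mulr0.
- by exists (x' + y'); rewrite !rmorphD mulrDr ex ey.
- by exists (x' * c); rewrite !rmorphM mulrA ex.
apply: contrapT => none.
have kill r : denom f s (a * r) -> f b * f r = 0.
  move=> sr; rewrite -rmorphM; case: (eqVneq (b * r) 0) => [->|br]; first exact: rmorph0.
  by case: none; exists r.
have : f b * 1 = 0.
  elim: (frac (s * f a)) => [|r x [r' sr] _|u v _ hu _ hv]; first exact: mulr0.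
    rewrite mulrA kill ?mul0r //.
    by exists r'; rewrite rmorphM mulrA.
  by rewrite mulrBr hu hv subrr.
by rewrite mulr1 -(rmorph0 f) => /injf /eqP; apply/negP.
Qed.

Lemma numer_denom s r : denom f s r -> s * f r = f (numer f s r).
Proof. by case=> r' e; rewrite (numer_eq injf e). Qed.

(** For each of the denominators r covering 1, s * f r is the image of some r'
    in R.  If r' were nonzero, density would give c with r * c in D and r' * c
    nonzero, although s * f (r * c) = 0.  So s kills a cover of 1. *)
Lemma nearly_killed s : nearly (fun r => s * f r = 0) -> s = 0.
Proof.
case=> D dD D0; rewrite -[s]mulr1.
elim: (frac s) => [|r x [r' sr] _|u v _ hu _ hv]; first exact: mulr0.
  rewrite mulrA sr; suff -> : r' = 0 by rewrite rmorph0 mul0r.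
  apply/eqP/negP => /negP/(dense_meets dD r) [c Dc].
  case/eqP; apply: injf; rewrite rmorphM -sr -mulrA -rmorphM D0 ?rmorph0 //.
by rewrite mulrBr hu hv subrr.
Qed.

Lemma numer_partial_map s : numer f s \in @partial_mapb R.
Proof.
apply/asboolP; exists (denom f s); first exact: denom_dense.
split=> [x y [x' ex] [y' ey]|x c [x' ex]].
  by apply: numer_eq => //; rewrite !rmorphD mulrDr (numer_eq injf ex) (numer_eq injf ey) ex ey.
by apply: numer_eq => //; rewrite !rmorphM mulrA ex (numer_eq injf ex).
Qed.

Definition germ_embed (s : S) : germ R := germ_of (PMap (numer_partial_map s)).

Lemma nearly_denom s : nearly (denom f s).
Proof. by exists (denom f s) => //; apply: denom_dense. Qed.

Lemma germ_embedB : zmod_morphism germ_embed.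
Proof.
move=> s t; rewrite /germ_embed -germ_ofB; apply/germ_eqP.
apply: nearly_sub (nearlyI (nearly_denom s) (nearly_denom t)) => r [ds dt].
apply: numer_eq => //; by rewrite pmapB rmorphB -!numer_denom // mulrBl.
Qed.

Lemma germ_embed_in r : germ_embed (f r) = germ_in r.
Proof.
by apply/germ_eqP/nearlyT => x /=; apply: numer_eq => //; rewrite rmorphM.
Qed.

Lemma germ_embedM : monoid_morphism germ_embed.
Proof.
split=> [|s t]; first by rewrite -(rmorph1 f) germ_embed_in.
rewrite [RHS]germ_mulE; apply/germ_eqP.
have := nearly_preim (pmapP (PMap (numer_partial_map t))) (nearly_denom s).
move/(nearlyI (nearly_denom t)); apply: nearly_sub => r /= [dt ds].
by apply: numer_eq => //; rewrite -mulrA numer_denom // numer_denom.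
Qed.

HB.instance Definition _ := GRing.isZmodMorphism.Build S (germ R) germ_embed germ_embedB.
HB.instance Definition _ := GRing.isMonoidMorphism.Build S (germ R) germ_embed germ_embedM.

Lemma germ_embed_inj : injective germ_embed.
Proof.
move=> s t /germ_eqP st; apply/eqP; rewrite -subr_eq0; apply/eqP.
apply: nearly_killed.
apply: nearly_sub (nearlyI st (nearlyI (nearly_denom s) (nearly_denom t))) => r /= [e [ds dt]].
by rewrite mulrBl !numer_denom // e subrr.
Qed.

End Embedding.

(** * The subring of two-sided fractions *)

Section SpanTransport.
Variables (R Q S : pzRingType) (f : {rmorphism R -> Q}) (i : {rmorphism R -> S}).
Variable v : {rmorphism Q -> S}.
Hypothesis vf : forall r, v (f r) = i r.

Lemma has_denom_map (A : Q -> Prop) (B : S -> Prop) s :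
  (forall x, A x -> B (v x)) -> has_denom f A s -> has_denom i B (v s).
Proof.
move=> AB; rewrite /has_denom /covers -(rmorph1 v).
elim=> [|r x [r' sr] Ax|x y _ hx _ hy]; rewrite ?rmorph0 ?rmorphB ?rmorphM.
- exact: left_span0.
- rewrite vf; apply: left_span_gen; last exact: AB.
  by exists r'; rewrite -!vf -rmorphM sr.
- exact: left_spanB.
Qed.

Hypothesis injv : injective v.

(** The unit lifts along [v] together with its expression as a sum of
    fractions, since the coefficients lie in the image of [v]. *)
Lemma has_denom_lift (A : S -> Prop) s :
  (forall x, A x -> exists y, x = v y) -> has_denom i A (v s) -> has_denom f (@everything Q) s.
Proof.
move=> Av; rewrite /has_denom /covers -(rmorph1 v).
suff lift u : left_span i A (denom i (v s)) u ->
    exists2 t, u = v t & left_span f (@everything Q) (denom f s) t.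
  by case/lift => t /injv ->.
elim=> [|r x [r' sr] /Av[y ->]|_ _ _ [x -> hx] _ [y -> hy]].
- by exists 0; [rewrite rmorph0|apply: left_span0].
- exists (f r * y); first by rewrite rmorphM vf.
  apply: left_span_gen => //; exists r'; apply: injv.
  by rewrite rmorphM !vf.
- by exists (x - y); [rewrite rmorphB|apply: left_spanB].
Qed.

End SpanTransport.

Lemma has_denom_sub (R S : pzRingType) (f : {rmorphism R -> S}) (A B : S -> Prop) s :
  (forall x, A x -> B x) -> has_denom f A s -> has_denom f B s.
Proof. exact: (@has_denom_map R S S f f idfun). Qed.

Section MaximalFlatEpi.
Variable R : pzRingType.

Let incl : {rmorphism R -> germ R} := @germ_in R.

(** Flatness on either side is expressed through fractions whose coefficients
    lie in the subring itself, so that these subrings can be compared inside the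
    ring of germs without tensor products. *)
Record flat_subring (A : germ R -> Prop) : Prop := FlatSubring {
  flat_subring_in : forall r, A (incl r);
  flat_subringM : forall p q, A p -> A q -> A (p * q);
  flat_subring_left : forall q, A q -> has_denom incl A q;
  flat_subring_right : forall q, A q -> has_denom (op_morph incl) A q }.

Inductive tot : germ R -> Prop :=
| tot_in r : tot (incl r)
| tot_gen A q : flat_subring A -> A q -> tot q
| totB p q : tot p -> tot q -> tot (p - q)
| totM p q : tot p -> tot q -> tot (p * q).

Lemma tot1 : tot 1.
Proof. by rewrite -(rmorph1 incl); apply: tot_in. Qed.

Lemma totM_op (p q : (germ R)^c) : tot p -> tot q -> tot (p * q).
Proof. by move=> ? ?; apply: totM. Qed.

(** A denominator of a generator comes from one of the flat subrings, and
    [tot] contains its coefficients; [stably_denomB] and [stably_denomM]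
    propagate denominators to the elements generated. *)
Lemma tot_stably q :
  tot q -> stably_denom incl tot q /\ stably_denom (op_morph incl) tot q.
Proof.
elim=> [r|A {}q flatA Aq|p {}q _ [pl pr] _ [ql qr]|p {}q _ [pl pr] _ [ql qr]].
- split=> a; apply: covers_all => [|c]; try exact: tot1.
    by exists (r * a * c); rewrite !rmorphM.
  by exists ((r : R^c) * a * c); rewrite !rmorphM.
- split=> a.
    apply: (@has_denom_sub _ _ _ A); first by move=> x; apply: tot_gen.
    by apply: flat_subring_left => //; apply: flat_subringM => //; apply: flat_subring_in.
  apply: (@has_denom_sub R^c (germ R)^c (op_morph incl) A); first by move=> x; apply: tot_gen.
  by apply: flat_subring_right => //; apply: flat_subringM => //; apply: flat_subring_in.
- split; first by apply: stably_denomB => //; apply: totM.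
  by apply: (@stably_denomB R^c (germ R)^c) => //; apply: totM_op.
- split; first by apply: stably_denomM => //; apply: totM.
  by apply: (@stably_denomM R^c (germ R)^c) => //; apply: totM_op.
Qed.

Lemma tot_left q : tot q -> has_denom incl tot q.
Proof. by case/tot_stably => /(_ 1); rewrite rmorph1 mulr1. Qed.

Lemma tot_right q : tot q -> has_denom (op_morph incl) tot q.
Proof. by case/tot_stably => _ /(_ 1); rewrite rmorph1 mulr1. Qed.

Definition totb : {pred germ R} := fun q => `[< tot q >].

Lemma totb_closed : subring_closed totb.
Proof.
split=> [|p q /asboolP hp /asboolP hq|p q /asboolP hp /asboolP hq]; apply/asboolP.
- exact: tot1.
- exact: totB.
- exact: totM.
Qed.

Record Qtot := QTot { Qtot_val : germ R; QtotP : Qtot_val \in totb }.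

HB.instance Definition _ := [isSub for Qtot_val].
HB.instance Definition _ := [Choice of Qtot by <:].
HB.instance Definition _ := GRing.SubChoice_isSubPzRing.Build (germ R) totb Qtot totb_closed.

Definition Qtot_incl : {rmorphism Qtot -> germ R} := val.

Definition to_Qtot (S : pzRingType) (h : {rmorphism S -> germ R})
  (htot : forall s, tot (h s)) (s : S) : Qtot := QTot (introT (asboolP _) (htot s)).

Section ToQtot.
Variables (S : pzRingType) (h : {rmorphism S -> germ R}) (htot : forall s, tot (h s)).
Lemma to_Qtot_zmod : zmod_morphism (to_Qtot htot).
Proof. by move=> s t; apply: val_inj; apply: (rmorphB h). Qed.
Lemma to_Qtot_monoid : monoid_morphism (to_Qtot htot).
Proof. by split=> [|s t]; apply: val_inj; [apply: (rmorph1 h)|apply: (rmorphM h)]. Qed.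
HB.instance Definition _ := GRing.isZmodMorphism.Build S Qtot (to_Qtot htot) to_Qtot_zmod.
HB.instance Definition _ := GRing.isMonoidMorphism.Build S Qtot (to_Qtot htot) to_Qtot_monoid.
End ToQtot.

Definition Qtot_in : {rmorphism R -> Qtot} := to_Qtot tot_in.

Lemma Qtot_in_inj : injective Qtot_in.
Proof. by move=> a b /(congr1 Qtot_val) /germ_in_inj. Qed.

Lemma Qtot_left : left_fractions Qtot_in.
Proof.
move=> q.
apply: (@has_denom_lift _ _ _ Qtot_in incl Qtot_incl _ val_inj tot) => //.
  by move=> x tx; exists (QTot (introT (asboolP _) tx)).
by apply: tot_left; apply/asboolP/QtotP.
Qed.

Lemma Qtot_right : left_fractions (op_morph Qtot_in).
Proof.
move=> q.
apply: (@has_denom_lift _ _ _ (op_morph Qtot_in) (op_morph incl)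
          (op_morph Qtot_incl) _ val_inj tot) => //.
  by move=> x tx; exists (QTot (introT (asboolP _) tx)).
by apply: tot_right; apply/asboolP/QtotP.
Qed.

(** The image of S is itself one of the generating subrings. *)
Lemma germ_embed_tot (S : pzRingType) (g : {rmorphism R -> S}) (injg : injective g)
    (fracl : left_fractions g) (fracr : left_fractions (op_morph g)) s :
  tot (germ_embed injg fracl s).
Proof.
pose v : {rmorphism S -> germ R} := germ_embed injg fracl.
have vg r : v (g r) = incl r by apply: germ_embed_in.
apply: (@tot_gen (fun q => exists x, v x = q)); last by exists s.
split.
- by move=> r; exists (g r).
- by move=> _ _ [x <-] [y <-]; exists (x * y); rewrite rmorphM.
- move=> _ [x <-]; apply: (has_denom_map vg) (fracl x) => y _.
  by exists y.
- move=> _ [x <-]; apply: (@has_denom_map R^c S^c (germ R)^c (op_morph g) (op_morph incl)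
    (op_morph v) vg _ _ _ _ (fracr x)) => y _.
  by exists y.
Qed.

End MaximalFlatEpi.

Theorem theorem5p1 (R : pzRingType) :
  exists (Q : pzRingType) (f : {rmorphism R -> Q}),
    [/\ injective f,
        ring_epi f,
        left_right_flat f
      & forall (S : pzRingType) (g : {rmorphism R -> S}),
          injective g -> ring_epi g -> left_right_flat g ->
          exists gbar : {rmorphism S -> Q},
            [/\ injective gbar,
                f =1 gbar \o g
              & forall h : {rmorphism S -> Q},
                  injective h -> f =1 h \o g -> h =1 gbar]].
Proof.
exists (Qtot R), (@Qtot_in R); split.
- exact: Qtot_in_inj.
- exact: left_fractions_epi (@Qtot_left R).
- split; first exact: (left_fractions_flat (@Qtot_in_inj R) (@Qtot_left R)).
  apply: left_flat_op.
  exact: (@left_fractions_flat _ _ (op_morph (Qtot_in R)) (@Qtot_in_inj R) (@Qtot_right R)).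
move=> S g injg epig [flatl flatr].
have fracl : left_fractions g := flat_epi_left_fractions flatl epig.
have fracr : left_fractions (op_morph g) :=
  flat_epi_left_fractions (right_flat_op flatr) (op_hom_epi epig).
pose gbar : {rmorphism S -> Qtot R} := to_Qtot (germ_embed_tot injg fracl fracr).
have fg : @Qtot_in R =1 gbar \o g.
  by move=> r; apply: val_inj; rewrite /= germ_embed_in.
exists gbar; split=> //; first by move=> s t /(congr1 (@Qtot_val R)) /germ_embed_inj.
by move=> h _ hg; apply: epig => r; rewrite -hg fg.
Qed.
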